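(* Let $k\ge 2$ and $n\ge 2$ be integers. Then the center of the $k$-Pell graph $\Pi_{n,k}$ is $$C(\Pi_{n,k})=\begin{cases}\Theta_n(k), & k\text{ even},\\ \Phi_n\!\left(\tfrac{k-1}{2},\tfrac{k+1}{2}\right), & k\text{ odd and } n\text{ even},\\ \Psi_n\!\left(\tfrac{k-1}{2},\tfrac{k+1}{2}\right), & k\text{ odd and } n\text{ odd}.\end{cases}$$ Further, $$|C(\Pi_{n,k})|=\begin{cases}F_{n+2}, & k\text{ even},\\ (n+4)\,2^{\frac{n}{2}-2}, & k\text{ odd and } n\text{ even},\\ 2^{\frac{n-1}{2}}, & k\text{ odd and } n\text{ odd}.\end{cases}$$ In addition, if $k$ is even, then the subgraph of $\Pi_{n,k}$ induced by $C(\Pi_{n,k})$ is isomorphic to the Fibonacci cube $\Gamma_n$.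
   Context: For an integer $k\ge 2$, a $k$-Pell string is a finite word over the alphabet $\{0,1,\ldots,k-1,kk\}$, i.e. a word over $\{0,1,\ldots,k\}$ in which every maximal run of the letter $k$ has even length. For $n\ge 0$, the $k$-Pell graph $\Pi_{n,k}$ has as vertices all $k$-Pell strings of length $n$, and two vertices are adjacent if one is obtained from the other either by replacing a single letter $i$ by $i+1$ (or vice versa) for some $i\in\{0,1,\ldots,k-2\}$, or by replacing one factor $(k-1)(k-1)$ by $kk$ (or vice versa), in such a way that the resulting string is again a $k$-Pell string. The center $C(G)$ of a graph is the set of vertices of minimum eccentricity. $F_m$ denotes the Fibonacci numbers ($F_0=0$, $F_1=1$, $F_m=F_{m-1}+F_{m-2}$). The Fibonacci cube $\Gamma_n$ is the graph whose vertices are binary strings of length $n$ with no two consecutive 1s, two being adjacent iff they differ in exactly one coordinate. For $k$ even, $\Theta_n(k)$ is the set of words $t_1\ldots t_n$ with every $t_i\in\{\frac k2-1,\frac k2\}$ and containing no two consecutive letters equal to $\frac k2-1$. For $n$ even and letters $a,b$, $\Phi_n(a,b)$ is the set of words of length $n$ that are concatenations of $n/2$ blocks from $\{aa,ab,ba\}$ (each block of length 2) such that no block $ba$ occurs before (to the left of) a block $ab$. For $n$ odd and letters $a,b$, $\Psi_n(a,b)$ is the set of words of length $n$ over $\{a,b\}$ that start and end with $a$, contain no factor $bb$, and in which every maximal run of $a$'s has odd length. Here $a=\frac{k-1}{2}$ and $b=\frac{k+1}{2}$ are regarded as letters (digits) of the alphabet $\{0,\ldots,k\}$. *)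

(* Defs.v *)
From mathcomp Require Import all_boot.
Set Implicit Arguments. Unset Strict Implicit. Unset Printing Implicit Defensive.

Notation word n k := (n.-tuple 'I_k.+1)%type.
Definition letters n k (w : word n k) : seq nat := map (@nat_of_ord k.+1) w.

(* k-Pell strings: words over {0,...,k-1, kk}, i.e. parseable as a
   concatenation of single letters 0..k-1 and the double letter kk. *)
Fixpoint pellseq (k : nat) (s : seq nat) : bool :=
  match s with
  | [::] => true
  | a :: s' =>
      if a == k then
        match s' with
        | b :: s'' => (b == k) && pellseq k s''
        | [::] => false
        end
      else pellseq k s'
  end.

Definition pell n k (w : word n k) : bool := pellseq k (letters w).

Definition step1 n k (u v : word n k) : bool :=
  [exists i : 'I_n,
    [&& [forall j : 'I_n, (j != i) ==> (tnth u j == tnth v j)],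
        (tnth u i < k) && (tnth v i < k) &
        ((tnth u i).+1 == tnth v i) || ((tnth v i).+1 == tnth u i)]].

Definition step2 n k (u v : word n k) : bool :=
  [exists i : 'I_n, exists j : 'I_n,
    [&& val j == (val i).+1,
        tnth u i == k.-1 :> nat, tnth u j == k.-1 :> nat,
        tnth v i == k :> nat, tnth v j == k :> nat &
        [forall l : 'I_n, ((l != i) && (l != j)) ==> (tnth u l == tnth v l)]]].

Definition pell_adj n k (u v : word n k) : bool :=
  [&& pell u, pell v & [|| step1 u v, step2 u v | step2 v u]].

Fixpoint ball n k (m : nat) (x : word n k) : {set word n k} :=
  match m with
  | 0 => [set x]
  | m'.+1 => ball m' x :|: [set z | [exists y in ball m' x, pell_adj y z]]
  end.

(* graph distance: the least m with y in the m-ball of x (the graph is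
   connected, so this m is < #|[set: word n k]|) *)
Definition dist n k (x y : word n k) : nat :=
  find (fun m => y \in ball m x) (iota 0 #|[set: word n k]|.+1).

Definition ecc n k (x : word n k) : nat :=
  \max_(y | pell y) dist x y.

Definition center n k : {set word n k} :=
  [set x : word n k | pell x & [forall y : word n k, pell y ==> (ecc x <= ecc y)]].

Definition thetaw (k : nat) (s : seq nat) : bool :=
  all (fun x => (x == k./2 - 1) || (x == k./2)) s &&
  ~~ infix [:: k./2 - 1; k./2 - 1] s.

Definition phiw (a b : nat) (s : seq nat) : Prop :=
  exists bs : seq (seq nat),
    [/\ all (fun p => p \in [:: [:: a; a]; [:: a; b]; [:: b; a]]) bs,
        flatten bs = s &
        forall i j, i < j < size bs ->
          ~ (nth [::] bs i = [:: b; a] /\ nth [::] bs j = [:: a; b])].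

Definition psiw (a b : nat) (s : seq nat) : Prop :=
  [/\ all (fun x => (x == a) || (x == b)) s,
      0 < size s, head 0 s = a /\ last 0 s = a,
      ~~ infix [:: b; b] s &
      forall i j, i <= j < size s ->
        (forall l, i <= l <= j -> nth 0 s l = a) ->
        (i = 0 \/ nth 0 s i.-1 <> a) ->
        (j.+1 = size s \/ nth 0 s j.+1 <> a) ->
        odd (j - i + 1)].

Fixpoint fib (m : nat) : nat :=
  match m with
  | 0 => 0
  | 1 => 1
  | (m'.+1 as p).+1 => fib p + fib m'
  end.

Definition fibvert n (x : n.-tuple bool) : bool := ~~ infix [:: true; true] x.
Definition fib_adj n (x y : n.-tuple bool) : bool :=
  #|[set i : 'I_n | tnth x i != tnth y i]| == 1.

(* Main.v *)
Require Import Defs.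
From mathcomp Require Import all_boot.
From mathcomp Require Import zify.
Set Implicit Arguments. Unset Strict Implicit. Unset Printing Implicit Defensive.

(* Encode a Pell string by replacing the second letter of each block [kk] with [k-1]. The codes
   are the words over [0..k] in which every [k] is followed by [k-1], and adjacency becomes a
   change of one letter by one. The graph distance is the L1 distance of the codes: at the first
   difference, lowering the larger letter stays among the codes.

   For [k = 2h], moving every letter as far as possible below [k] gives eccentricity at least
   [n h], and a farther target exists exactly if a letter is not in [{h-1, h}] or some factor
   [(h-1)(h-1)] can be sent to [k(k-1)].

   For [k = 2m+1], cutting a word into consecutive pairs gives eccentricity at least
   [n m + floor(n/2)], since every pair of letters has a target at distance [2m+1] or more. If
   [n] is odd, any even-indexed letter can be left out of the pairing, so each of them must be
   [m]. If [n] is even, equality means that the pairs are [m m], [m (m+1)] or [(m+1) m], and once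
   a letter [m+1] stands at an even index, the rest is an odd word of the previous kind. *)

(** * Pell strings and their codes *)

Section Encoding.
Variable k : nat.

(* The flag records that the previous letter opened a block [kk]. *)
Fixpoint pellb (b : bool) (s : seq nat) : bool :=
  if s is a :: s' then (b ==> (a == k)) && pellb (~~ b && (a == k)) s' else ~~ b.

Fixpoint enc (b : bool) (s : seq nat) : seq nat :=
  if s is a :: s' then (if b then k.-1 else a) :: enc (~~ b && (a == k)) s'
  else [::].

(** In a code only the first letter of a block is [k], so the flag is simply [a == k]. In [enc] it
    must alternate along a run of [k], hence the extra [~~ b]. *)
Fixpoint dec (b : bool) (s : seq nat) : seq nat :=
  if s is a :: s' then (if b then k else a) :: dec (a == k) s' else [::].

Fixpoint codeb (b : bool) (s : seq nat) : bool :=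
  if s is a :: s' then (b ==> (a == k.-1)) && codeb (a == k) s' else ~~ b.

Definition bounded (s : seq nat) := all (fun a => a <= k) s.

Definition code n (s : seq nat) := [&& size s == n, bounded s & codeb false s].

Lemma pellseqE s : pellseq k s = pellb false s.
Proof.
have [m] := ubnP (size s); elim: m s => // m IH [|a [|b s]] //= lt_s.
case: (a == k) => /=; first by rewrite IH //; lia.
exact: (IH (b :: s)).
Qed.

Lemma size_enc b s : size (enc b s) = size s.
Proof. by elim: s b => //= a s IH b; rewrite IH. Qed.

Lemma size_dec b s : size (dec b s) = size s.
Proof. by elim: s b => //= a s IH b; rewrite IH. Qed.

Lemma bounded_enc b s : bounded s -> bounded (enc b s).
Proof.
elim: s b => //= a s IH b /andP[ha hs]; rewrite IH // andbT.
by case: b; lia.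
Qed.

Lemma bounded_dec b s : bounded s -> bounded (dec b s).
Proof.
elim: s b => //= a s IH b /andP[ha hs]; rewrite IH // andbT.
by case: b; lia.
Qed.

Hypothesis k_gt0 : 0 < k.

Lemma pred_k_neq : (k.-1 == k) = false.
Proof. by lia. Qed.

Lemma codeb_enc b s : pellb b s -> codeb b (enc b s).
Proof.
elim: s b => //= a s IH [] /= => [/andP[h hs]|/IH//].
by rewrite eqxx pred_k_neq IH.
Qed.

Lemma pellb_dec b s : codeb b s -> pellb b (dec b s).
Proof.
elim: s b => //= a s IH [] /= => [/andP[h hs]|/IH//].
by move: hs; rewrite (eqP h) eqxx pred_k_neq => /IH.
Qed.

Lemma encK b s : pellb b s -> dec b (enc b s) = s.
Proof.
elim: s b => //= a s IH [] /= => [/andP[h hs]|/IH->//].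
by rewrite pred_k_neq IH // (eqP h).
Qed.

Lemma decK b s : codeb b s -> enc b (dec b s) = s.
Proof.
elim: s b => //= a s IH [] /= => [/andP[h hs]|/IH->//].
by move: hs; rewrite (eqP h) pred_k_neq => /IH ->.
Qed.

Lemma codebW s : codeb true s -> codeb false s.
Proof. by case: s => //= a s /andP[]. Qed.

(** This and the next lemmas treat words without [k], which are their own codes. All central words
    will be of this kind, so they can be described without mentioning codes. *)
Lemma codeb_lt s : all (fun a => a < k) s -> codeb false s.
Proof.
by elim: s => //= a s IH /andP[ha /IH]; rewrite (ltn_eqF ha).
Qed.

Lemma dec_lt s : all (fun a => a < k) s -> dec false s = s.
Proof.
by elim: s => //= a s IH /andP[ha /IH]; rewrite (ltn_eqF ha) => ->.
Qed.

Lemma bounded_lt s : all (fun a => a < k) s -> bounded s.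
Proof. by apply: sub_all => a /ltnW. Qed.

Lemma enc_lt s : all (fun a => a < k) s -> enc false s = s.
Proof. by move=> hs; rewrite -{1}(dec_lt hs) decK // codeb_lt. Qed.

Lemma pellb_lt s : all (fun a => a < k) s -> pellb false s.
Proof. by move=> hs; rewrite -(dec_lt hs) pellb_dec // codeb_lt. Qed.

Definition enc_state b p := foldl (fun b a => ~~ b && (a == k)) b p.
Definition dec_state b p := foldl (fun _ a => a == k) b p.

Lemma enc_cat b p q : enc b (p ++ q) = enc b p ++ enc (enc_state b p) q.
Proof. by elim: p b => //= a p IH b; rewrite IH. Qed.

Lemma dec_cat b p q : dec b (p ++ q) = dec b p ++ dec (dec_state b p) q.
Proof. by elim: p b => //= a p IH b; rewrite IH. Qed.

Lemma pellb_catr b p q : pellb b (p ++ q) -> pellb (enc_state b p) q.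
Proof. by elim: p b => //= a p IH b /andP[_ /IH]. Qed.

Lemma codeb_catr b p q : codeb b (p ++ q) -> codeb (dec_state b p) q.
Proof. by elim: p b => //= a p IH b /andP[_ /IH]. Qed.

End Encoding.

(** * The L1 distance and descent among codes *)

Fixpoint l1 (s t : seq nat) : nat :=
  match s, t with
  | a :: s', b :: t' => (a - b) + (b - a) + l1 s' t'
  | _, _ => 0
  end.

Lemma l1xx s : l1 s s = 0.
Proof. by elim: s => //= a s ->; rewrite subnn. Qed.

Lemma l1_cat p q r : l1 (p ++ q) (p ++ r) = l1 q r.
Proof. by elim: p => //= a p ->; rewrite subnn. Qed.

Lemma l1C s t : l1 s t = l1 t s.
Proof. by elim: s t => [|a s IH] [|b t] //=; rewrite IH; lia. Qed.

Lemma l1_triangle s t r : size s = size t -> size t = size r ->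
  l1 s r <= l1 s t + l1 t r.
Proof.
elim: s t r => [|a s IH] [|b t] [|c r] //= [e1] [e2].
by have := IH _ _ e1 e2; lia.
Qed.

Lemma l1_bound k s t : bounded k s -> bounded k t -> l1 s t <= size s * k.
Proof.
elim: s t => [|a s IH] [|b t] //= /andP[ha hs] /andP[hb ht].
by have := IH _ hs ht; lia.
Qed.

Definition lowers (s s' : seq nat) :=
  exists p a q, s = p ++ a.+1 :: q /\ s' = p ++ a :: q.

(* At the first letter where [s] and [t] differ, lowering the larger one keeps it a code:
   the letter before is not [k], since a [k] forces the next letter in both words. *)
Lemma l1_descend k s t b : 0 < k -> size s = size t -> s <> t ->
  bounded k s -> bounded k t -> codeb k b s -> codeb k b t ->
  (exists s', [/\ lowers s s', bounded k s', codeb k b s' & l1 s t = (l1 s' t).+1]) \/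
  (exists t', [/\ lowers t t', bounded k t', codeb k b t' & l1 s t = (l1 s t').+1]).
Proof.
move=> k0; elim: s t b => [|x s IH] [|y t] b //= [est] ne.
move=> /andP[hx hs] /andP[hy ht] /andP[bx cs] /andP[bY ct].
have cF c r : codeb k c r -> codeb k false r by case: c => // /codebW.
case: (ltngtP x y) => [lt|lt|eq].
- right; exists (y.-1 :: t); split => /=.
  + by exists [::], y.-1, t; rewrite prednK //; lia.
  + by rewrite ht andbT; lia.
  + have -> : (y.-1 == k) = false by lia.
    by rewrite (cF _ _ ct) andbT; case: b bx bY => //=; lia.
  + by lia.
- left; exists (x.-1 :: s); split => /=.
  + by exists [::], x.-1, s; rewrite prednK //; lia.
  + by rewrite hs andbT; lia.
  + have -> : (x.-1 == k) = false by lia.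
    by rewrite (cF _ _ cs) andbT; case: b bx bY => //=; lia.
  + by lia.
subst y; have ne' : s <> t by move=> e; apply: ne; rewrite e.
case: (IH t (x == k) est ne' hs ht cs ct) => [[s' [[p [a [q [-> ->]]]] h1 h2 h3]]|].
  left; exists (x :: p ++ a :: q); split => //=; rewrite ?h1 ?hx ?h2 ?bx //.
    by exists (x :: p), a, q.
  by lia.
move=> [t' [[p [a [q [eq ->]]]] h1 h2 h3]].
right; exists (x :: p ++ a :: q); split => //=; rewrite ?h1 ?hx ?h2 ?bx //.
  by exists (x :: p), a, q; rewrite eq.
by lia.
Qed.

(** * Graph distance as L1 distance of codes, and a criterion for the center *)

Section Words.
Variables n k : nat.
Hypothesis k_gt0 : 0 < k.
Implicit Types u v w : word n k.

Lemma size_letters w : size (letters w) = n.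
Proof. by rewrite size_map size_tuple. Qed.

Lemma nth_letters w (i : 'I_n) : nth 0 (letters w) i = tnth w i.
Proof.
rewrite (nth_map (tnth w i)) ?size_tuple //.
by rewrite -tnth_nth.
Qed.

Lemma bounded_letters w : bounded k (letters w).
Proof. by apply/allP => _ /mapP[a _ ->]; rewrite -ltnS. Qed.

Lemma letters_inj : injective (@letters n k).
Proof. by move=> u v /(inj_map val_inj) /val_inj. Qed.

Lemma lettersP s : size s = n -> bounded k s -> {w : word n k | letters w = s}.
Proof.
move=> hs bs; have h : size (map (@inord k) s) == n by rewrite size_map hs.
exists (Tuple h); rewrite /letters /= -map_comp -[RHS]map_id.
apply/eq_in_map => a /(allP bs) ha /=.
by rewrite inordK.
Qed.

Lemma split_at (s t : seq nat) i : size s = size t -> i < size s ->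
  (forall j, j < size s -> j != i -> nth 0 s j = nth 0 t j) ->
  exists p q, [/\ size p = i, s = p ++ nth 0 s i :: q & t = p ++ nth 0 t i :: q].
Proof.
move=> est hi h; exists (take i s), (drop i.+1 s); split.
- by rewrite size_takel // ltnW.
- by rewrite -drop_nth // cat_take_drop.
rewrite -{1}(cat_take_drop i t); congr cat.
  apply: (@eq_from_nth _ 0); rewrite !size_takel -?est 1?ltnW // => j hj.
  by rewrite !nth_take // h //; lia.
rewrite (drop_nth 0) -?est //; congr cons.
apply: (@eq_from_nth _ 0); rewrite !size_drop -?est // => j hj.
by rewrite !nth_drop h //; lia.
Qed.

Lemma step1P u v :
  reflect (exists p a b q, [/\ letters u = p ++ a :: q, letters v = p ++ b :: q,
             a < k, b < k & (a.+1 == b) || (b.+1 == a)])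
          (step1 u v).
Proof.
apply: (iffP existsP) => [[i /and3P[/forallP h /andP[hu hv] huv]]|].
  have [||j hj ne|p [q [_ eu ev]]] := @split_at (letters u) (letters v) i.
  - by rewrite !size_letters.
  - by rewrite size_letters.
  - rewrite size_letters in hj.
    have /implyP/(_ ne)/eqP := h (Ordinal hj).
    by rewrite (nth_letters u (Ordinal hj)) (nth_letters v (Ordinal hj)) => ->.
  rewrite !nth_letters in eu ev.
  by exists p, (tnth u i : nat), (tnth v i : nat), q.
move=> [p [a [b [q [eu ev ha hb hab]]]]].
have hp : size p < n by rewrite -(size_letters u) eu size_cat /=; lia.
exists (Ordinal hp).
have Eu : tnth u (Ordinal hp) = a :> nat.
  by rewrite -nth_letters eu /= nth_cat ltnn subnn.
have Ev : tnth v (Ordinal hp) = b :> nat.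
  by rewrite -nth_letters ev /= nth_cat ltnn subnn.
rewrite Eu Ev ha hb hab /= !andbT.
apply/forallP => j; apply/implyP => ne.
apply/eqP/val_inj; rewrite /= -!nth_letters eu ev !nth_cat.
case: ltnP => // hj; have {}ne : j != size p :> nat by [].
by case E: (j - size p) => //; lia.
Qed.

Lemma step2P u v :
  reflect (exists p q, letters u = p ++ k.-1 :: k.-1 :: q /\
                       letters v = p ++ k :: k :: q)
          (step2 u v).
Proof.
apply: (iffP existsP) => [[i /existsP[j /and5P[/eqP ij /eqP ui /eqP uj /eqP vi]]]|].
  move=> /andP[/eqP vj /forallP h].
  have h' l : l < n -> l != i :> nat -> l != j :> nat ->
      nth 0 (letters u) l = nth 0 (letters v) l.
    move=> hl n1 n2; have := h (Ordinal hl); rewrite -!val_eqE /= n1 n2 /= => /eqP.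
    by rewrite (nth_letters u (Ordinal hl)) (nth_letters v (Ordinal hl)) => ->.
  exists (take i (letters u)), (drop j.+1 (letters u)).
  have lu : i < n by []. have lj : j < n by []. simpl in ij.
  have sp w : letters w = take i (letters w) ++ nth 0 (letters w) i ::
      nth 0 (letters w) j :: drop j.+1 (letters w).
    rewrite -drop_nth ?size_letters // ij -drop_nth ?size_letters //.
    by rewrite cat_take_drop.
  split; first by rewrite [LHS]sp !nth_letters ui uj.
  rewrite [LHS]sp !nth_letters vi vj; congr cat; last congr (_ :: _ :: _).
    apply: (@eq_from_nth _ 0); rewrite !size_takel ?size_letters 1?ltnW //.
    by move=> l hl; rewrite !nth_take // h' //; lia.
  apply: (@eq_from_nth _ 0); rewrite !size_drop !size_letters // => l hl.
  by rewrite !nth_drop h' //; lia.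
move=> [p [q [eu ev]]].
have hp : (size p).+1 < n by rewrite -(size_letters u) eu size_cat /=; lia.
have hp' := ltnW hp.
exists (Ordinal hp'); apply/existsP; exists (Ordinal hp).
rewrite -!nth_letters eu ev /= !nth_cat ltnn subnn ltnNge leqnSn /= subSn //.
rewrite subnn /= !eqxx /=.
apply/forallP => l; apply/implyP; rewrite -!val_eqE /= => /andP[n1 n2].
apply/eqP; rewrite -!nth_letters eu ev !nth_cat.
case: ltnP => // hl.
by case E: (l - size p) => [|[|x]] //; lia.
Qed.

Definition wenc w := enc k false (letters w).

Lemma wenc_code w : pell w -> code k n (wenc w).
Proof.
rewrite /pell pellseqE => hw; rewrite /code size_enc size_letters eqxx.
by rewrite bounded_enc ?bounded_letters //= codeb_enc.
Qed.

Lemma wencP s : code k n s -> {w : word n k | pell w /\ wenc w = s}.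
Proof.
move=> /and3P[/eqP hs bs cs].
have [||w hw] := @lettersP (dec k false s).
- by rewrite size_dec.
- exact: bounded_dec.
by exists w; rewrite /pell pellseqE /wenc hw pellb_dec ?decK.
Qed.

Lemma wenc_inj u v : pell u -> pell v -> wenc u = wenc v -> u = v.
Proof.
rewrite /pell !pellseqE => hu hv e; apply: letters_inj.
by rewrite -(encK k_gt0 hu) -(encK k_gt0 hv) [enc _ _ _]e.
Qed.

Lemma pell_adjC u v : pell_adj u v = pell_adj v u.
Proof.
rewrite /pell_adj andbCA; do 2!congr andb; rewrite [step2 _ _ || _]orbC; congr orb.
apply: eq_existsb => i; rewrite [(tnth u i < k) && _]andbC orbC; congr andb.
by apply: eq_forallb => j; rewrite [tnth v j == _]eq_sym.
Qed.

(** If the lowered letter is [k], the next code letter is [k-1] in both codes, and decoding gives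
    [kk] against [(k-1)(k-1)]. Otherwise decoding leaves both letters as they are, and they differ
    by one below [k]. *)
Lemma lowers_adj u v : pell u -> pell v -> lowers (wenc u) (wenc v) -> pell_adj u v.
Proof.
move=> pu pv [p [a [q [eu ev]]]]; rewrite /pell_adj pu pv /=.
have /and3P[_ _ cu] := wenc_code pu; have /and3P[_ bv cv] := wenc_code pv.
have /and3P[_ bu _] := wenc_code pu.
move: (pu) (pv); rewrite /pell !pellseqE => /(encK k_gt0) Eu /(encK k_gt0) Ev.
rewrite -!/(wenc _) eu ev in Eu Ev cu cv bu.
have {bu} ha : a < k by have := allP bu a.+1; rewrite mem_cat inE eqxx orbT; apply.
have aF : (a == k) = false by lia.
have := codeb_catr cu; have := codeb_catr cv; rewrite !dec_cat /= aF in Eu Ev *.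
(* Directly after a [k] both codes would have the letter [k-1], but here they have [a.+1] and
   [a]. *)
case: (dec_state k false p) Eu Ev => Eu Ev /=.
  by move=> /andP[/eqP ? _] /andP[/eqP ? _]; lia.
move=> cq; case: eqP => [ak|/eqP ak] in Eu *.
- case: q cq Eu Ev {eu ev cu cv} => [|c q] //= cq Eu Ev /andP[/eqP ck _].
  subst c; rewrite (pred_k_neq k_gt0) in Eu Ev.
  apply/orP; right; apply/orP; right; apply/step2P.
  exists (dec k false p), (dec k false q); rewrite -Eu -Ev ak.
  by rewrite (_ : a = k.-1) //; lia.
move=> _; apply/orP; left; apply/step1P.
exists (dec k false p), a.+1, a, (dec k false q); rewrite -Eu -Ev; split=> //; lia.
Qed.

(** A [step1] involves no [k], so the flag for the remaining letters does not change. In a [step2]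
    the factors are encoded as [(k-1)(k-1)] and [k(k-1)], which differ in one letter only. *)
Lemma adj_l1 u v : pell_adj u v -> l1 (wenc u) (wenc v) <= 1.
Proof.
have s2 x y : pell x -> step2 x y -> l1 (wenc x) (wenc y) <= 1.
  move=> px /step2P[p [q [ex ey]]].
  move: px; rewrite /pell pellseqE ex => /pellb_catr; rewrite /wenc ex ey !enc_cat l1_cat /=.
  rewrite (pred_k_neq k_gt0); case: enc_state => //= _.
  by rewrite eqxx /= l1xx; lia.
move=> /and3P[pu pv /or3P[|/s2->//|]]; last by rewrite l1C; apply: s2.
move=> /step1P[p [a [b [q [eu ev ha hb hab]]]]].
rewrite /wenc eu ev !enc_cat l1_cat /=.
rewrite (ltn_eqF ha) (ltn_eqF hb) !andbF l1xx; case: ifP => _; lia.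
Qed.

(** Balls are defined by adding an edge at the far end. Since [l1_descend] may lower either word, an
    edge at the center of the ball is needed too. *)
Lemma ball_adjl m u u' v : pell_adj u u' -> v \in ball m u' -> v \in ball m.+1 u.
Proof.
move=> a; elim: m v => [|m IH] v.
  rewrite !inE => /eqP->; apply/orP; right; apply/existsP; exists u.
  by rewrite inE eqxx.
rewrite [v \in ball m.+1 u']inE => /orP[/IH h|]; first by rewrite [v \in _]inE h.
rewrite inE => /existsP[y /andP[/IH hy ay]].
rewrite [v \in _]inE; apply/orP; right; rewrite inE; apply/existsP; exists y.
by rewrite hy.
Qed.

Lemma ballP m u v : pell u -> pell v -> (v \in ball m u) = (l1 (wenc u) (wenc v) <= m).
Proof.
move=> pu pv; apply/idP/idP.
  elim: m v pv => [|m IH] v pv; first by rewrite inE => /eqP->; rewrite l1xx.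
  rewrite [v \in _]inE => /orP[/IH-/(_ pv)|]; first by lia.
  rewrite inE => /existsP[y /andP[hy a]].
  have py : pell y by case/and3P: a.
  have := @l1_triangle (wenc u) (wenc y) (wenc v); rewrite /wenc !size_enc !size_letters.
  by move=> /(_ erefl erefl); have := IH _ py hy; have := adj_l1 a; rewrite /wenc; lia.
elim: m u v pu pv => [|m IH] u v pu pv h.
  have [/(wenc_inj pu pv)->|ne] := eqVneq (wenc u) (wenc v); first by rewrite inE.
  have /and3P[/eqP su bu cu] := wenc_code pu; have /and3P[/eqP sv bv cv] := wenc_code pv.
  have := @l1_descend k _ _ false k_gt0 (etrans su (esym sv)) (elimN eqP ne) bu bv cu cv.
  by move=> [[s' [_ _ _]]|[s' [_ _ _]]]; lia.
have [/(wenc_inj pu pv)->|ne] := eqVneq (wenc u) (wenc v).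
  by apply: (subsetP _ _ (set11 v)); elim: (m.+1) => //= r /subset_trans; apply; apply: subsetUl.
have /and3P[/eqP su bu cu] := wenc_code pu; have /and3P[/eqP sv bv cv] := wenc_code pv.
have := @l1_descend k _ _ false k_gt0 (etrans su (esym sv)) (elimN eqP ne) bu bv cu cv.
have sz s s' : lowers s s' -> size s' = size s.
  by move=> [p [a [q [-> ->]]]]; rewrite !size_cat.
move=> [[s' [lo b' c' e]]|[s' [lo b' c' e]]].
  have [|u' [pu' eu']] := @wencP s'; first by rewrite /code (sz _ _ lo) su eqxx b'.
  rewrite -eu' in lo e; apply: (ball_adjl (lowers_adj pu pu' lo)).
  by apply: IH => //; lia.
have [|v' [pv' ev']] := @wencP s'; first by rewrite /code (sz _ _ lo) sv eqxx b'.
rewrite -ev' in lo e; rewrite [v \in _]inE; apply/orP; right; rewrite inE.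
apply/existsP; exists v'; rewrite pell_adjC (lowers_adj pv pv' lo) andbT.
by apply: IH => //; lia.
Qed.

(** [dist] searches only up to the number of words, [k.+1 ^ n]; this puts the bound of [l1_bound]
    within that range. *)
Lemma bernoulli : n * k <= k.+1 ^ n.
Proof. by elim: n => // m IH; have := expn_gt0 k.+1 m; rewrite expnS; nia. Qed.

Lemma distE u v : pell u -> pell v -> dist u v = l1 (wenc u) (wenc v).
Proof.
move=> pu pv; rewrite /dist; set N := #|_|; set d := l1 _ _.
have dN : d <= N.
  rewrite /N cardsT card_tuple card_ord; apply: leq_trans bernoulli.
  have /and3P[/eqP su bu _] := wenc_code pu; have /and3P[_ bv _] := wenc_code pv.
  by rewrite -[in X in _ <= X]su; apply: l1_bound.
(* The list searched is an initial segment of the naturals, so the index of the first hit is the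
   least [m] with [d <= m]. *)
rewrite (eq_find (a2 := fun m => d <= m)); last by move=> m; rewrite ballP.
have hs : has (fun m => d <= m) (iota 0 N.+1).
  by apply/hasP; exists d => //; rewrite mem_iota; lia.
have := nth_find 0 hs; move: (hs); rewrite has_find size_iota => lt.
rewrite nth_iota // add0n => h1; apply/eqP; rewrite eqn_leq h1 andbT leqNgt.
by apply/negP => lt2; have := before_find 0 lt2; rewrite nth_iota ?leqnn; lia.
Qed.

(** Words in [P] have eccentricity at most [r], all words have at least [r], and those whose code
    fails [P] have at least [r+1]. As [P] is inhabited, the minimum is [r] and is attained exactly
    on [P]. *)
Lemma center_char (P : pred (seq nat)) (r : nat) :
  (forall s, P s -> all (fun a => a < k) s) ->
  (exists2 s, size s = n & P s) ->
  (forall s t, size s = n -> P s -> code k n t -> l1 s t <= r) ->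
  (forall s, code k n s -> exists2 t, code k n t & r + ~~ P s <= l1 s t) ->
  forall w, (w \in center n k) = P (letters w).
Proof.
move=> Plt [s0 sz0 P0] ub lb.
have Penc w : P (letters w) -> pell w /\ wenc w = letters w.
  by move=> /Plt hw; rewrite /pell pellseqE pellb_lt // /wenc enc_lt.
have eub w : P (letters w) -> ecc w <= r.
  move=> Pw; have [pw ew] := Penc w Pw; apply/bigmax_leqP => y py.
  by rewrite distE // ew; apply: ub; rewrite ?size_letters ?wenc_code.
have elb w : pell w -> r + ~~ P (wenc w) <= ecc w.
  move=> pw; have [t ct h] := lb _ (wenc_code pw).
  have [y [py ey]] := wencP ct; apply: leq_trans h _.
  by rewrite -ey -distE //; apply: (leq_bigmax_cond y py).
have [w0 hw0] := lettersP sz0 (bounded_lt (Plt _ P0)).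
have Pw0 : P (letters w0) by rewrite hw0.
move=> w; rewrite inE; apply/andP/idP => [[pw /forallP h]|Pw].
  have /implyP/(_ (Penc _ Pw0).1) le := h w0.
  have Pw : P (wenc w) by have := elb _ pw; have := eub _ Pw0; case: (P _) => //=; lia.
  (* So far [P] holds for the code of [w]; such a code contains no [k] and therefore decodes to
     itself. *)
  suff -> : letters w = wenc w by [].
  move: pw; rewrite /pell pellseqE => /(encK k_gt0) <-.
  by rewrite -/(wenc w) dec_lt // Plt.
split; first exact: (Penc w Pw).1.
apply/forallP => y; apply/implyP => py; apply: leq_trans (eub _ Pw) _.
by apply: leq_trans (elb _ py); rewrite leq_addr.
Qed.

End Words.

Lemma code0 k : code k 0 [::].
Proof. by []. Qed.

Lemma code_cons k n a t : a < k -> code k n t -> code k n.+1 (a :: t).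
Proof.
by move=> ha /and3P[/eqP<- b c]; rewrite /code /= eqxx b (ltn_eqF ha) c ltnW.
Qed.

Lemma code_domino k n t : 0 < k -> code k n t -> code k n.+2 (k :: k.-1 :: t).
Proof.
move=> k0 /and3P[/eqP<- b c].
by rewrite /code /= eqxx b !eqxx (pred_k_neq k0) c leqnn leq_pred.
Qed.

Lemma seq_pair_ind T (P : seq T -> Prop) : P [::] -> (forall a, P [:: a]) ->
  (forall a b s, P s -> P (a :: b :: s)) -> forall s, P s.
Proof.
move=> P0 P1 P2 s; have [n] := ubnP (size s); elim: n s => // n IH [|a [|b s]] //= lt_s.
by apply/P2/IH; lia.
Qed.

(** * Eccentricities for [k = 2h] *)

Section EvenAlphabet.
Variable h : nat.
Hypothesis h_gt0 : 0 < h.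
Let k := h.*2.

(* The flag records that the previous letter is [h - 1]. *)
Fixpoint theta (c : bool) (s : seq nat) : bool :=
  if s is a :: s' then
    ((a == h) || (a == h - 1) && ~~ c) && theta (a == h - 1) s'
  else true.

Lemma theta_lt c s : theta c s -> all (fun a => a < k) s.
Proof. by elim: s c => //= a s IH c /andP[ha /IH->]; rewrite andbT /k; lia. Qed.

Lemma thetaE s : thetaw k s = theta false s.
Proof.
rewrite /thetaw /k doubleK.
suff H : forall c, theta c s =
    all (fun x => (x == h - 1) || (x == h)) s &&
    ~~ infix [:: h - 1; h - 1] (if c then h - 1 :: s else s) by rewrite H.
elim: s => [|a s IH] c.
  by case: c => //=; rewrite andbF.
rewrite [LHS]/= IH; have [->|na] := eqVneq a (h - 1).
  have -> : (h - 1 == h) = false by lia.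
  by case: c; rewrite /= !eqxx ?prefix0s ?andbF //= andbT.
have inf : infix [:: h - 1; h - 1] (a :: s) = infix [:: h - 1; h - 1] s.
  by rewrite /= eq_sym (negbTE na).
rewrite andFb orbF [all _ (a :: s)]/= (negbTE na) orFb andbA; congr (_ && ~~ _).
case: c; last by rewrite inf.
by rewrite -inf /= eqxx ![h - 1 == a]eq_sym (negbTE na).
Qed.

(* The term [c && b] pays for a pair [(h-1) k] at the previous position, which exceeds [h] by one. *)
Lemma theta_l1_le c b s t : size s = size t -> theta c s ->
  bounded k t -> codeb k b t -> l1 s t + (c && b) <= size s * h.
Proof.
elim: s c b t => [|a s IH] c b [|x t] //=.
  by move=> _ _ _ /negbTE->; rewrite andbF.
move=> [est] /andP[ha th] /andP[hx bt] /andP[bx ct].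
have := IH _ _ _ est th bt ct; rewrite /k in hx bx *.
by case: c ha => /= ha; case: b bx => /= bx; lia.
Qed.

(** Sending letters from [h] on to [0] and smaller ones to [k-1] gains at least [h] per letter, and
    at least [h+1] outside [{h-1, h}]. Sending [(h-1)(h-1)] to [k(k-1)] gains [2h+1]. *)
Lemma theta_l1_ge s : exists2 t, code k (size s) t &
  size s * h + ~~ theta false s <= l1 s t.
Proof.
have k0 : 0 < k by rewrite /k; lia.
have [m] := ubnP (size s); elim: m s => // m IH [|a s] /= lt_s; first by exists [::].
have IH1 : exists2 t, code k (size s) t & size s * h + ~~ theta false s <= l1 s t.
  by apply: IH; lia.
(* Extending the target by one letter suffices if no surplus is owed, if the tail already yields it,
   or if [a] yields it. What remains is a word starting with [(h-1)(h-1)]. *)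
have far : theta false (a :: s) || ~~ theta false s || (a != h) && (a != h - 1) ->
    exists2 t, code k (size s).+1 t &
    (size s).+1 * h + ~~ theta false (a :: s) <= l1 (a :: s) t.
  move=> hyp; case: IH1 => t ct ht.
  exists ((if h <= a then 0 else k.-1) :: t); first by apply: code_cons => //; case: ifP; lia.
  move: hyp ht => /=; rewrite /k; case: ifP; case: theta; case: (theta _ s) => /=; lia.
have [/far//|] := boolP (theta false (a :: s) || ~~ theta false s || (a != h) && (a != h - 1)).
rewrite !negb_or negbK => /andP[/andP[nt ts] e]; case: s ts nt IH1 lt_s {far} => [|b s].
  by move=> _ /=; lia.
move=> /= ts nt _ lt_s.
have [t ct ht] : exists2 t, code k (size s) t & size s * h + ~~ theta false s <= l1 s t.
  by apply: IH; lia.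
exists (k :: k.-1 :: t); first exact: code_domino.
have ea : a = h - 1 by move: nt ts e; case: (theta _ s); lia.
have eb : b = h - 1 by move: nt ts e; case: (theta _ s); lia.
by rewrite /= /k; case: (theta _ _) ht => /=; case: (_ && _) => /=; lia.
Qed.

Lemma center_even n w : (w \in center n k) = theta false (letters w).
Proof.
apply: (@center_char _ _ _ _ (n * h)).
- by rewrite /k; lia.
- by move=> s /theta_lt.
- exists (nseq n h); rewrite ?size_nseq //; elim: (n) => //= m IH.
  by rewrite eqxx (_ : (h == h - 1) = false) //; lia.
- move=> s t <- ts /and3P[/eqP sz bt ct].
  by have := theta_l1_le (esym sz) ts bt ct; rewrite addn0.
by move=> s /and3P[/eqP<- _ _]; apply: theta_l1_ge.
Qed.

End EvenAlphabet.

(** * Eccentricities for [k = 2m+1] *)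

Section OddAlphabet.
Variable m : nat.
Hypothesis m_gt0 : 0 < m.
Let k := m.*2.+1.

(* Words of odd length with [m] at even indices and [m] or [m+1] at odd ones, counting from 0;
   in [phi] a letter [m+1] at an even index opens the part made of blocks [(m+1) m] and [m m]. *)
Fixpoint psi (s : seq nat) : bool :=
  match s with
  | [::] => false
  | [:: a] => a == m
  | a :: b :: s' => [&& a == m, (b == m) || (b == m.+1) & psi s']
  end.

Fixpoint phi (s : seq nat) : bool :=
  match s with
  | [::] => true
  | a :: s1 =>
      if a == m.+1 then psi s1
      else if s1 is b :: s' then [&& a == m, (b == m) || (b == m.+1) & phi s'] else false
  end.

Lemma psi_lt s : psi s -> all (fun a => a < k) s.
Proof.
elim/seq_pair_ind: s => //= [a|a b s IH]; first by rewrite /k; lia.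
by move=> /and3P[ha hb /IH->]; rewrite /k; lia.
Qed.

Lemma phi_lt s : phi s -> all (fun a => a < k) s.
Proof.
elim/seq_pair_ind: s => //= [a|a b s IH]; first by case: ifP.
case: ifP => [ha|_ /and3P[ha hb /IH->]]; last by rewrite /k; lia.
by move=> /(@psi_lt (b :: s)) /= ->; rewrite /k; lia.
Qed.

(** If [x] is [k], then [x'] is [2m] and the distances are at most [m+1] and [m]. Otherwise [x] is
    at most [2m], and they are at most [m] and [m+1]. *)
Lemma pair_l1_le b a a' x x' t : a = m -> (a' == m) || (a' == m.+1) ->
  bounded k [:: x, x' & t] -> codeb k b [:: x, x' & t] ->
  (a - x) + (x - a) + ((a' - x') + (x' - a')) <= m.*2.+1.
Proof.
move=> -> ha /= /and3P[hx hx' _] /and3P[_ h _]; rewrite /k in hx hx' h.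
by move: h; case: eqP => /=; lia.
Qed.

(** The letter left over after pairing is [m], and its target is within [m] because a code cannot
    end with [k]. *)
Lemma psi_l1_le b s t : size s = size t -> psi s -> bounded k t -> codeb k b t ->
  l1 s t <= size s * m + (size s)./2.
Proof.
elim/seq_pair_ind: s t b => [|a|a a' s IH] [|x [|x' t]] b //=.
  by rewrite /k => _ ha /andP[hx _] /andP[bx]; case: eqP => //=; lia.
move=> [est] /and3P[/eqP ha ha' ps] bt ct.
have := pair_l1_le ha ha' bt ct; case/and3P: bt => _ _ bt; case/and3P: ct => _ _ ct.
by have := IH _ _ est ps bt ct; lia.
Qed.

(** A letter [m+1] at an even index contributes at most [m+1], and the odd rest is bounded by
    [psi_l1_le]; together this is the bound by pairs. *)
Lemma phi_l1_le b s t : ~~ odd (size s) -> size s = size t -> phi s ->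
  bounded k t -> codeb k b t -> l1 s t <= size s * m + (size s)./2.
Proof.
elim/seq_pair_ind: s t b => [|a|a a' s IH] [|x [|x' t]] b //=.
rewrite negbK => od [est].
case: eqP => [ea|_] => [ps /andP[hx bt] /andP[_ ct]|/and3P[/eqP ha ha' ps] bt ct].
  have := @psi_l1_le _ (a' :: s) (x' :: t) _ ps bt ct; rewrite /= est => /(_ erefl).
  by rewrite /k in hx; lia.
have := pair_l1_le ha ha' bt ct; case/and3P: bt => _ _ bt; case/and3P: ct => _ _ ct.
by have := IH _ _ od est ps bt ct; lia.
Qed.

(** The farthest target letter that puts no constraint on the next one; its distance from [a] is
    [m + |a - m|]. *)
Definition far_letter a := if m <= a then 0 else m.*2.

Lemma code_far n a t : code k n t -> code k n.+1 (far_letter a :: t).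
Proof. by apply: code_cons; rewrite /far_letter /k; case: ifP; lia. Qed.

Lemma far_l1 a s t : l1 (a :: s) (far_letter a :: t) = m + ((a - m) + (m - a)) + l1 s t.
Proof. by rewrite /= /far_letter; case: ifP; lia. Qed.

Lemma domino_code n t : code k n t -> code k n.+2 (m.*2.+1 :: m.*2 :: t).
Proof. exact: (@code_domino k). Qed.

(** The surplus vanishes only for [m m], [m (m+1)] and [(m+1) m]. If both letters are at most [m],
    the target [k(k-1)] is used, at distance [4m+1-a-a']; otherwise both letters are sent to their
    far letters. *)
Lemma pair_l1_ge a a' n s t : code k n t -> exists2 t', code k n.+2 t' &
  m.*2.+1 + ((a < m) || (a' < m) || (m.+1 < a + a' - m)) + l1 s t
  <= l1 [:: a, a' & s] t'.
Proof.
move=> ct; have [le|gt] := leqP (a + a') m.*2.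
  have [/andP[l1 l2]|] := boolP ((a <= m) && (a' <= m)).
    by exists (m.*2.+1 :: m.*2 :: t); [exact: domino_code|rewrite /=; lia].
  by exists (far_letter a :: far_letter a' :: t); rewrite ?code_far // !far_l1; lia.
by exists (far_letter a :: far_letter a' :: t); rewrite ?code_far // !far_l1; lia.
Qed.

Lemma odd_l1_ge s : exists2 t, code k (size s) t & size s * m + (size s)./2 <= l1 s t.
Proof.
elim/seq_pair_ind: s => [|a|a a' s [t ct ht]]; first by exists [::].
  by exists [:: far_letter a]; rewrite ?code_far // far_l1 /=; lia.
have [t' ct' ht'] := pair_l1_ge a a' s ct.
by exists t' => //; apply: leq_trans ht'; rewrite /=; lia.
Qed.

(** A first letter other than [m] is left out of the pairing: alone it gains [m+1], and the even
    rest still provides all the pairs. A first letter [m] is paired with the next. *)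
Lemma psi_l1_ge s : odd (size s) -> exists2 t, code k (size s) t &
  size s * m + (size s)./2 + ~~ psi s <= l1 s t.
Proof.
elim/seq_pair_ind: s => [|a|a a' s IH] // od.
  by exists [:: far_letter a]; [exact: code_far (code0 _)|rewrite far_l1 /=; lia].
have [ea|na] := eqVneq a m; last first.
  have [t ct ht] := odd_l1_ge (a' :: s).
  exists (far_letter a :: t); first exact: code_far.
  rewrite far_l1; move: od ht => /=; rewrite negbK uphalf_half (negbTE na) => -> /=.
  by lia.
rewrite /= negbK in od; have [t ct ht] := IH od.
have [t' ct' ht'] := pair_l1_ge a a' s ct.
exists t' => //; apply: leq_trans ht'; move: ht => /=; subst a.
by case: psi; rewrite ?andbT ?andbF /=; lia.
Qed.

Lemma phi_l1_ge s : ~~ odd (size s) -> exists2 t, code k (size s) t &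
  size s * m + (size s)./2 + ~~ phi s <= l1 s t.
Proof.
elim/seq_pair_ind: s => [|a|a a' s IH] // od; first by exists [::].
rewrite /= negbK in od; have [ea|na] := eqVneq a m.+1.
  have [|t ct ht] := @psi_l1_ge (a' :: s); first by rewrite /= od.
  exists (far_letter a :: t); first exact: code_far.
  rewrite far_l1; move: ht => /=; rewrite ea eqxx; case: (X in ~~ X) => /=; lia.
have [t ct ht] := IH od.
have [t' ct' ht'] := pair_l1_ge a a' s ct.
have [lt|le] := leqP a m.+1.
  exists t' => //; apply: leq_trans ht'; move: ht => /=.
  by rewrite (negbTE na); case: phi; rewrite ?andbT ?andbF /=; lia.
(* Here [a] is at least [m+2]. Taken alone it exceeds [m] by two, which makes up for the one pair
   lost in the odd rest and leaves a surplus of one. *)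
have [r cr hr] := odd_l1_ge (a' :: s).
exists (far_letter a :: r); first exact: code_far.
rewrite far_l1.
by move: hr => /=; lia.
Qed.

Lemma center_odd_odd n w : odd n -> (w \in center n k) = psi (letters w).
Proof.
move=> od; apply: (@center_char _ _ _ _ (n * m + n./2)) => //.
- exact: psi_lt.
- exists (nseq n m); rewrite ?size_nseq // -[n]odd_double_half od.
  elim: n./2 => [|p IH]; first exact: eqxx.
  by rewrite doubleS; apply/and3P; split; [exact: eqxx | rewrite eqxx | exact: IH].
- by move=> s t <- ts /and3P[/eqP sz bt ct]; apply: psi_l1_le ct.
by move=> s /and3P[/eqP e _ _]; rewrite -e; apply: psi_l1_ge; rewrite e.
Qed.

Lemma center_odd_even n w : ~~ odd n -> (w \in center n k) = phi (letters w).
Proof.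
move=> od; apply: (@center_char _ _ _ _ (n * m + n./2)) => //.
- exact: phi_lt.
- exists (nseq n m); rewrite ?size_nseq // -[n]odd_double_half (negbTE od).
  by elim: n./2 => // p IH; rewrite doubleS /= !eqxx ltn_eqF.
- by move=> s t e ts /and3P[/eqP sz bt ct]; rewrite -e; apply: phi_l1_le ct; rewrite ?e.
by move=> s /and3P[/eqP e _ _]; rewrite -e; apply: phi_l1_ge; rewrite e.
Qed.

End OddAlphabet.

(** * Agreement with the block and run descriptions *)

Lemma psi_cons_flatten m bs :
  all (fun p => p \in [:: [:: m; m]; [:: m.+1; m]]) bs -> psi m (m :: flatten bs).
Proof.
elim: bs => [_|p bs IH /= /andP[hp /IH hbs]]; first exact: eqxx.
move: hp; rewrite !inE => /orP[]/eqP->; apply/and3P; split;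
  by [exact: eqxx | rewrite eqxx ?orbT | exact: hbs].
Qed.

Lemma psi_flatten m s : psi m (m :: s) ->
  exists2 bs, all (fun p => p \in [:: [:: m; m]; [:: m.+1; m]]) bs & flatten bs = s.
Proof.
elim/seq_pair_ind: s => [|a|a b s IH]; first by exists [::].
  by rewrite /= !andbF.
move=> /and3P[_ ha hp].
have eb : b = m by case: s hp {IH} => [/eqP//|c s /and3P[/eqP]].
rewrite eb in hp *; have [bs hbs e] := IH hp.
exists ([:: a; m] :: bs); last by rewrite /= e.
rewrite /= hbs andbT !inE.
by case/orP: ha => /eqP->; rewrite eqxx ?orbT.
Qed.

(** The first block [(m+1) m] is where [phi] passes to [psi]. Dropping its letter [m+1] leaves an
    [m] followed by blocks [m m] and [(m+1) m], the form treated by [psi_flatten] and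
    [psi_cons_flatten]. *)
Lemma phiP m s : phi m s <-> phiw m m.+1 s.
Proof.
have mF : (m == m.+1) = false by lia.
split.
  elim/seq_pair_ind: s => [|a|a b s IH].
  - by move=> _; exists [::]; split=> // i j /andP[_]; rewrite ltn0.
  - by rewrite /=; case: ifP.
  rewrite /=; case: eqP => [-> ps|_ /and3P[/eqP-> hb /IH[bs [hbs e no]]]].
    have eb : b = m by case: s ps {IH} => [/eqP//|c s /and3P[/eqP]].
    subst b; case/psi_flatten: ps => bs hbs <-; exists ([:: m.+1; m] :: bs).
    split => //=.
      rewrite !inE eqxx !orbT /=; apply: sub_all hbs => p; rewrite !inE.
      by case/orP=> ->; rewrite ?orbT.
    move=> i [|j] /andP[// lt lt'] [_ /= e]; have := all_nthP [::] hbs j lt'.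
    by rewrite e !inE !eqseq_cons eqxx !(eq_sym m.+1) mF ?andbF.
  exists ([:: m; b] :: bs); split => /=; last 1 first.
  - move=> [|i] [|j] //= h [e1 e2]; last by apply: (no i j).
    by case: e1; lia.
  - by rewrite hbs andbT !inE; case/orP: hb => /eqP->; rewrite eqxx ?orbT.
  by rewrite e.
move=> [bs [hbs <- no]]; elim: bs hbs no {s} => // p bs IH /= /andP[hp hbs] no.
have {}IH : phi m (flatten bs).
  by apply: IH => // i j h; apply: (no i.+1 j.+1).
move: hp no; rewrite !inE => /or3P[]/eqP-> no; try by rewrite /= mF !eqxx ?orbT.
(* The current block is [(m+1) m], so the order condition excludes [m (m+1)] from the rest. *)
suff: psi m (m :: flatten bs) by rewrite /= !eqxx.
apply: psi_cons_flatten; apply/(all_nthP [::]) => j hj.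
have := all_nthP [::] hbs j hj; rewrite !inE => /or3P[->//|/eqP e|->]; last by rewrite orbT.
by case: (no 0 j.+1).
Qed.

Lemma psi_nth m s : odd (size s) -> psi m s <->
  forall i, i < size s -> (nth 0 s i == m) || odd i && (nth 0 s i == m.+1).
Proof.
elim/seq_pair_ind: s => [|a|a b s IH] //.
  split; first by move=> /= /eqP-> [|i] //= _; rewrite eqxx.
  by move=> /(_ 0 isT); rewrite /= orbF.
rewrite /= negbK => /IH{}IH; split.
  move=> /and3P[/eqP-> hb /IH h] [|[|i]] //=; first by rewrite eqxx.
  by rewrite negbK !ltnS; apply: h.
move=> h; apply/and3P; split.
- by have := h 0 isT; rewrite /= orbF.
- by have := h 1 isT.
by apply/IH => i hi; have := h i.+2; rewrite /= negbK; apply.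
Qed.

(** If every [m+1] has an odd index, a maximal run of [m] starts and ends at even indices.
    Conversely, by strong induction the run before a letter [m+1] starts at [0] or just after an odd
    index; having odd length it ends at an even index, so that letter has an odd one. *)
Lemma psiP m s : odd (size s) -> psi m s <-> psiw m m.+1 s.
Proof.
move=> od; rewrite psi_nth //; split.
  move=> h.
  have ev i : i < size s -> ~~ odd i -> nth 0 s i = m.
    by move=> hi /negbTE ei; have := h i hi; rewrite ei orbF => /eqP.
  have s0 : 0 < size s by lia.
  split => //.
  - by apply/(all_nthP 0) => i /h; case: eqP => //= _ /andP[].
  - by rewrite -nth0 -nth_last !ev //; lia.
  - apply/infixP => -[p [q e]].
    have n0 : nth 0 s (size p) = m.+1 by rewrite e nth_cat ltnn subnn.
    have n1 : nth 0 s (size p).+1 = m.+1 by rewrite e nth_cat ltnNge leqnSn subSnn.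
    have sz : (size p).+1 < size s by rewrite e !size_cat /=; lia.
    have [op|ep] := boolP (odd (size p)).
      by have := ev _ sz; rewrite n1 /= op => /(_ isT); lia.
    by have := ev _ (ltnW sz) ep; rewrite n0; lia.
  move=> i j /andP[ij js] run hi hj.
  have ei : ~~ odd i.
    case: hi => [->//|ne]; apply/negP => oi; apply: ne; apply: ev; lia.
  have ej : ~~ odd j.
    case: hj => [|ne]; first by lia.
    have [lt|] := ltnP j.+1 (size s); last by lia.
    by apply/negP => oj; apply: ne; apply: ev => //=; rewrite negbK.
  by lia.
move=> [hab s0 [h0 hl] nbb run].
have letter i : i < size s -> (nth 0 s i == m) || (nth 0 s i == m.+1).
  by move=> hi; apply: (all_nthP 0 hab).
have nb i : i.+1 < size s -> nth 0 s i = m.+1 -> nth 0 s i.+1 = m.+1 -> False.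
  move=> hi e1 e2; move/negP: nbb; apply; apply/infixP.
  exists (take i s), (drop i.+2 s); rewrite -[LHS](cat_take_drop i s).
  by rewrite (drop_nth 0 (ltnW hi)) e1 (drop_nth 0 hi) e2.
elim/ltn_ind => i IH hi; have [//|/= nm] := eqVneq (nth 0 s i) m.
have ib : nth 0 s i = m.+1 by have := letter i hi; rewrite (negbTE nm) => /eqP.
rewrite ib eqxx andbT; case: i IH hi nm ib => [|i] IH hi nm ib.
  by rewrite -nth0 in h0; rewrite h0 eqxx in nm.
have ia : nth 0 s i = m.
  have := letter i (ltnW hi); case: eqP => //= _ /eqP e.
  by case: (nb i).
(* [j] is the left end of the run of [m] that ends at [i]. *)
have ex : exists j, (j <= i) && all (fun l => nth 0 s l == m) (index_iota j i.+1).
  by exists i; rewrite leqnn /= /index_iota subSnn /= ia eqxx.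
case: (ex_minnP ex) => j /andP[ji /allP hj] min.
have jrun l : j <= l <= i -> nth 0 s l = m.
  by move=> hlr; apply/eqP/hj; rewrite mem_index_iota ltnS.
have hjl : j = 0 \/ nth 0 s j.-1 <> m.
  case: j ji hj min jrun => [|j] ji hj min jrun; [by left|right => /= e].
  have := min j; rewrite ltnn => H; suff: false by []. apply: H.
  rewrite ltnW //=; apply/allP => l; rewrite mem_index_iota => hlr.
  have [->|ne] := eqVneq l j; first by apply/eqP.
  by apply/eqP/jrun; lia.
have oj : ~~ odd j.
  case: hjl => [->//|ne]; case: j ne ji {hj min jrun} => // j /= ne ji.
  have := IH j; rewrite ltnS ltnW // => /(_ isT).
  have -> : j < size s by lia.
  move=> /(_ isT); case: eqP => //= _ /andP[->//].
have := run j i; rewrite ji (ltnW hi) => /(_ isT jrun hjl) H.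
have : odd (i - j + 1) by apply: H; right => e; rewrite e eqxx in nm.
by rewrite /=; lia.
Qed.

(** * Counting the central words by their first letters *)

Definition nwords n k (P : pred (seq nat)) := #|[set w : word n k | P (letters w)]|.

Lemma eq_nwords n k P Q : P =1 Q -> nwords n k P = nwords n k Q.
Proof. by move=> e; apply: eq_card => w; rewrite !inE e. Qed.

Lemma nwords0 k (P : pred (seq nat)) : nwords 0 k P = P [::].
Proof.
rewrite /nwords; case e: (P [::]).
  apply: (@eq_card1 _ [tuple]) => w; rewrite (tuple0 w) !inE /letters /= e.
  by rewrite eqxx.
by apply: eq_card0 => w; rewrite (tuple0 w) inE /letters /= e.
Qed.

Lemma nwordsS n k (P : pred (seq nat)) :
  nwords n.+1 k P = \sum_(a < k.+1) nwords n k (fun s => P ((a : nat) :: s)).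
Proof.
under eq_bigr do rewrite /nwords -sum1dep_card.
rewrite /nwords -sum1dep_card pair_big_dep /=.
rewrite (reindex (fun p : 'I_k.+1 * word n k => [tuple of p.1 :: p.2])) //=.
exists (fun t : word n.+1 k => (thead t, [tuple of behead t])).
  by move=> [a t] _ /=; rewrite theadE; congr pair; apply: val_inj.
by move=> t _ /=; rewrite -tuple_eta.
Qed.

Lemma nwords2 n k (P : pred (seq nat)) x y : x != y -> x <= k -> y <= k ->
  (forall a s, P (a :: s) -> (a == x) || (a == y)) ->
  nwords n.+1 k P =
    nwords n k (fun s => P (x :: s)) + nwords n k (fun s => P (y :: s)).
Proof.
move=> xy hx hy h; rewrite nwordsS.
rewrite (bigD1 (inord x)) //= (bigD1 (inord y)) /=; last first.
  by rewrite -val_eqE /= !inordK // eq_sym.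
rewrite !inordK // big1 ?addn0 // => a /andP[n1 n2].
apply: eq_card0 => w; rewrite inE; apply/negP => /h.
by move: n1 n2; rewrite -!val_eqE /= !inordK // => /negbTE-> /negbTE->.
Qed.

Lemma nwords1 n k (P : pred (seq nat)) x : x <= k ->
  (forall a s, P (a :: s) -> a == x) ->
  nwords n.+1 k P = nwords n k (fun s => P (x :: s)).
Proof.
move=> hx h; rewrite nwordsS (bigD1 (inord x)) //= inordK // big1 ?addn0 // => a n1.
apply: eq_card0 => w; rewrite inE; apply/negP => /h.
by move: n1; rewrite -val_eqE /= inordK // => /negbTE->.
Qed.

(** Both flags are counted together: from [false] the letters [h] and [h-1] lead to the flags
    [false] and [true], while from [true] only [h] is allowed. *)
Lemma card_theta n h : 0 < h ->
  nwords n h.*2 (theta h false) = fib n.+2 /\ nwords n h.*2 (theta h true) = fib n.+1.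
Proof.
move=> h0; elim: n => [|n [IH1 IH2]]; first by rewrite !nwords0.
have hF : (h == h - 1) = false by lia.
split.
  rewrite (@nwords2 _ _ _ h (h - 1)) ?hF //; try lia.
    rewrite -[fib _]/(fib n.+2 + fib n.+1) -IH1 -IH2; congr (_ + _).
      by apply: eq_nwords => s /=; rewrite eqxx hF.
    by apply: eq_nwords => s /=; rewrite eqxx orbT.
  by move=> a s /= /andP[]; rewrite andbT.
rewrite (@nwords1 _ _ _ h) //; first 1 last.
- by lia.
- by move=> a s /= /andP[]; rewrite andbF orbF.
by rewrite -IH1; apply: eq_nwords => s /=; rewrite eqxx hF.
Qed.

(** Only the [p] letters at odd indices are free. *)
Lemma card_psi p m : 0 < m -> nwords p.*2.+1 m.*2.+1 (psi m) = 2 ^ p.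
Proof.
move=> m0; elim: p => [|p IH].
  rewrite (@nwords1 _ _ _ m) ?nwords0 /= ?eqxx //; first by lia.
  by move=> a [|b s] //= /and3P[].
rewrite doubleS (@nwords1 _ _ _ m); first 1 last.
- by lia.
- by move=> a [|b s] //= /and3P[].
rewrite (@nwords2 _ _ _ m m.+1); first 1 last.
- by lia.
- by lia.
- by lia.
- by move=> a s /= /and3P[].
by rewrite expnS mul2n -[RHS]addnn -IH; congr (_ + _); apply: eq_nwords => s /=;
  rewrite !eqxx ?orbT.
Qed.

(** With [f p] for the count, [f (p+1) = 2 f p + 2^p]: after a first [m] the second letter has two
    choices, and after a first [m+1] a [psi] word of length [2p+1] follows. *)
Lemma card_phi p m : 0 < m -> 2 * nwords p.*2 m.*2.+1 (phi m) = (p + 2) * 2 ^ p.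
Proof.
move=> m0; elim: p => [|p IH]; first by rewrite nwords0.
have mF : (m == m.+1) = false by lia.
rewrite doubleS (@nwords2 _ _ _ m m.+1); first 1 last.
- by lia.
- by lia.
- by lia.
- by move=> a [|b s] /=; case: (a == m.+1); rewrite ?orbT // orbF => /and3P[].
rewrite [X in _ + X](_ : _ = 2 ^ p); last first.
  by rewrite -(card_psi p m0); apply: eq_nwords => s /=; rewrite eqxx.
rewrite (@nwords2 _ _ _ m m.+1); first 1 last.
- by lia.
- by lia.
- by lia.
- by move=> a s /=; rewrite mF => /and3P[].
have E x : (x == m) || (x == m.+1) ->
    nwords p.*2 m.*2.+1 (fun s => phi m [:: m, x & s]) = nwords p.*2 m.*2.+1 (phi m).
  by move=> hx; apply: eq_nwords => s /=; rewrite mF eqxx hx.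
by rewrite !E ?eqxx ?orbT // expnS; lia.
Qed.

Lemma card_center n k P : (forall w : word n k, (w \in center n k) = P (letters w)) ->
  #|center n k| = nwords n k P.
Proof. by move=> h; apply: eq_card => w; rewrite h inE. Qed.

(** * The subgraph induced by the center for even [k] *)

Section FibonacciCube.
Variables n h : nat.
Hypothesis h_gt0 : 0 < h.
Let k := h.*2.

Definition low_letters (w : word n k) : n.-tuple bool :=
  [tuple of map (fun a : 'I_k.+1 => a == h - 1 :> nat) w].

Lemma infix_low (s : seq nat) :
  infix [:: true; true] (map (fun a => a == h - 1) s) = infix [:: h - 1; h - 1] s.
Proof.
elim: s => // a s IH; rewrite -[LHS]/(prefix [:: true; true] _ || infix _ _) IH.
congr orb; case: s {IH} => [|b s] /=; first by rewrite !andbF.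
rewrite !prefix0s !andbT !(eq_sym (h - 1)).
by case: (a == _); case: (b == _).
Qed.

Lemma val_low_letters w : val (low_letters w) = map (fun a => a == h - 1) (letters w).
Proof. by rewrite /= /letters -map_comp. Qed.

Lemma tnth_low_letters w i : tnth (low_letters w) i = (tnth w i == h - 1 :> nat).
Proof. by rewrite tnth_map. Qed.

Lemma center_letter (w : word n k) i : w \in center n k ->
  (tnth w i == h :> nat) || (tnth w i == h - 1 :> nat).
Proof.
rewrite center_even // -thetaE // => /andP[/(all_nthP 0)/(_ i)].
rewrite size_letters nth_letters doubleK => /(_ (ltn_ord i)).
by rewrite orbC.
Qed.

(** Marking the letters [h-1] turns the forbidden factor [(h-1)(h-1)] into two consecutive ones.
    Central words contain no [k], so their edges are all of type [step1], and two different letters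
    of [{h-1, h}] always differ by one. *)
Lemma center_fib_iso : exists f : word n k -> n.-tuple bool,
  [/\ {in center n k &, injective f},
      f @: center n k = [set x | fibvert x] &
      {in center n k &, forall u v, pell_adj u v = fib_adj (f u) (f v)}].
Proof.
have hF : (h == h - 1) = false by lia.
exists low_letters; split.
- move=> u v cu cv e; apply: eq_from_tnth => i; apply: val_inj => /=.
  have := center_letter i cu; have := center_letter i cv.
  have : tnth (low_letters u) i = tnth (low_letters v) i by rewrite e.
  by rewrite !tnth_low_letters; lia.
- apply/setP => x; rewrite inE; apply/imsetP/idP => [[w cw ->]|hx].
    rewrite /fibvert val_low_letters infix_low.
    by move: cw; rewrite center_even // -thetaE // /thetaw doubleK => /andP[].
  have [||w hw] := @lettersP n k (map (fun b : bool => if b then h - 1 else h) x).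
  + by rewrite size_map size_tuple.
  + by apply/allP => _ /mapP[b _ ->]; rewrite /k; case: b; lia.
  have ex : map (fun a => a == h - 1) (letters w) = x.
    by rewrite hw -map_comp -[RHS]map_id; apply: eq_map => -[] /=; rewrite ?eqxx ?hF.
  exists w; last by apply: val_inj; rewrite val_low_letters ex.
  rewrite center_even // -thetaE // /thetaw doubleK -infix_low ex -/(fibvert x) hx andbT hw.
  by apply/allP => _ /mapP[b _ ->]; case: b; rewrite eqxx ?orbT.
move=> u v cu cv.
have pu : pell u by move: cu; rewrite inE => /andP[].
have pv : pell v by move: cv; rewrite inE => /andP[].
have lt w i : w \in center n k -> tnth w i < k.
  by move=> /(center_letter i)/orP[]/eqP->; rewrite /k; lia.
have s2 x y : y \in center n k -> step2 x y = false.
  move=> cy; apply/negbTE/negP => /existsP[i /existsP[j /and5P[_ _ _ /eqP e _]]].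
  by have := lt _ i cy; rewrite e ltnn.
rewrite /pell_adj pu pv !s2 // !orbF /=.
have dif i : (tnth (low_letters u) i != tnth (low_letters v) i) = (tnth u i != tnth v i).
  rewrite !tnth_low_letters -!val_eqE /=.
  by have := center_letter i cu; have := center_letter i cv; lia.
apply/existsP/cards1P => -[i].
  move=> /and3P[/forallP hi _ ne]; exists i; apply/setP => j; rewrite !inE dif.
  apply/idP/eqP => [nj|->]; last by rewrite -val_eqE /=; lia.
  by apply: contraTeq nj => /(implyP (hi j)) ->.
move=> /setP hi; exists i; rewrite !lt //=; apply/andP; split.
  apply/forallP => j; apply/implyP => nj; have := hi j.
  by rewrite !inE dif (negbTE nj) => /negbFE.
have := hi i; rewrite !inE dif eqxx -val_eqE /=.
by have := center_letter i cu; have := center_letter i cv; lia.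
Qed.

End FibonacciCube.

Theorem theorem4p2 (k n : nat) (hk : 2 <= k) (hn : 2 <= n) :
  (~~ odd k ->
     (forall w : word n k, w \in center n k <-> thetaw k (letters w))
     /\ #|center n k| = fib n.+2
     /\ (exists f : word n k -> n.-tuple bool,
           [/\ {in center n k &, injective f},
               f @: center n k = [set x | fibvert x] &
               {in center n k &, forall u v, pell_adj u v = fib_adj (f u) (f v)}]))
  /\
  (odd k -> ~~ odd n ->
     (forall w : word n k, w \in center n k <-> phiw k./2 k./2.+1 (letters w))
     /\ 4 * #|center n k| = (n + 4) * 2 ^ n./2)
  /\
  (odd k -> odd n ->
     (forall w : word n k, w \in center n k <-> psiw k./2 k./2.+1 (letters w))
     /\ #|center n k| = 2 ^ n./2).
Proof.
have k0 : 0 < k./2 by lia.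
split; last split.
- move=> ev; have {ev} ek : k = k./2.*2 by lia.
  move: k0 ek; move: (k./2) => h h0 ek; subst k; split.
    by move=> w; rewrite center_even // thetaE.
  split; last exact: center_fib_iso.
  by rewrite (card_center (center_even h0 (n := n))); case: (card_theta n h0).
- move=> od on; have {od} ek : k = k./2.*2.+1 by lia.
  move: k0 ek; move: (k./2) => m m0 ek; subst k.
  have C w := center_odd_even m0 w on; split.
    by move=> w; rewrite C; apply: phiP.
  rewrite (card_center C); have en : n = n./2.*2 by lia.
  (* Doubling [card_phi] turns [p + 2] into [n + 4]; the factor [4] avoids the negative exponent at
     [n = 2]. *)
  rewrite {1 2}en; have := card_phi n./2 m0; lia.
move=> od on; have {od} ek : k = k./2.*2.+1 by lia.
move: k0 ek; move: (k./2) => m m0 ek; subst k.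
have C w := center_odd_odd m0 w on; split.
  by move=> w; rewrite C; apply: psiP; rewrite size_letters.
rewrite (card_center C); have en : n = n./2.*2.+1 by lia.
by rewrite {1}en card_psi.
Qed.
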